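(* Let $\|\cdot\|$ be an arbitrary norm on $\mathbb{R}^n$ with dual norm $\|\cdot\|_*$, let $P_0 \in \mathcal{M}(\mathbb{R}^n)$ be a nominal distribution, let $r \ge 0$, and let $\mathcal{P} = \{P \in \mathcal{M}(\mathbb{R}^n) \mid W_1(P, P_0) \le r\}$. Assume that the feasible set $\mathcal{X} \subset \mathbb{R}^n$ is nonempty and compact, and let $\alpha \in [0,1)$. Then for every $x \in \mathcal{X}$, $$\sup_{P \in \mathcal{P}} \mathrm{CVaR}_\alpha^P\big(R(x, \boldsymbol{w})\big) \;=\; \mathrm{CVaR}_\alpha^{P_0}\big(R(x, \boldsymbol{w})\big) \;+\; \Big(\frac{r}{1-\alpha}\Big) \sup_{v \in \mathcal{X}} \|x - v\|_* .$$
   Context: The dual norm is $\|x\|_* := \sup\{x^\top y \mid \|y\| \le 1\}$ for $x \in \mathbb{R}^n$. $\mathcal{M}(\mathbb{R}^n)$ denotes the collection of Borel probability measures $P$ on $\mathbb{R}^n$ with $\mathbb{E}_P[\|\boldsymbol{w}\|] < \infty$, where $\boldsymbol{w}$ denotes a random vector in $\mathbb{R}^n$ with distribution $P$ under $\mathbb{E}_P$. The type-1 Wasserstein distance between $P_1, P_2 \in \mathcal{M}(\mathbb{R}^n)$ is $$W_1(P_1, P_2) := \inf_{\pi \in \Pi(P_1, P_2)} \int_{\mathbb{R}^n \times \mathbb{R}^n} \|z_1 - z_2\| \, \pi(dz_1, dz_2),$$ where $\Pi(P_1,P_2)$ is the set of all joint distributions in $\mathcal{M}(\mathbb{R}^n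 \times \mathbb{R}^n)$ with marginals $P_1$ and $P_2$. The (ex post) regret of a decision $x \in \mathcal{X}$ given a realization $w \in \mathbb{R}^n$ is $R(x, w) := w^\top x - \inf_{y \in \mathcal{X}} w^\top y$. For $\alpha \in [0,1)$, the conditional value-at-risk of regret of $x \in \mathcal{X}$ under a distribution $P \in \mathcal{P}$ is $$\mathrm{CVaR}_\alpha^P\big(R(x, \boldsymbol{w})\big) := \inf_{\tau \in \mathbb{R}} \Big\{ \tau + \frac{1}{1-\alpha} \mathbb{E}_P\big[\max\{R(x, \boldsymbol{w}) - \tau, 0\}\big] \Big\}.$$ *)

(* Defs.v *)
From HB Require Import structures.
From mathcomp Require Import all_boot all_order all_algebra.
From mathcomp Require Import all_classical all_reals all_analysis.

Set Implicit Arguments.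
Unset Strict Implicit.
Unset Printing Implicit Defensive.

Import Order.TTheory GRing.Theory Num.Theory.
Import numFieldTopology.Exports numFieldNormedType.Exports.

Local Open Scope classical_set_scope.
Local Open Scope ring_scope.

(* An arbitrary norm is a function, kept apart from the norm `|x| that the
   library puts on matrices; nonnegativity follows from the three fields. *)
Record is_norm (R : realType) (V : lmodType R) (N : V -> R) : Prop := IsNorm {
  is_norm_triangle : forall x y : V, N (x + y) <= N x + N y;
  is_norm_homog : forall (a : R) (x : V), N (a *: x) = `|a| * N x;
  is_norm_eq0 : forall x : V, N x = 0 -> x = 0 }.

Definition dot (R : realType) (n : nat) (u v : 'cV[R]_n) : R :=
  (u^T *m v) ord0 ord0.

(* On R^n, with N a norm, the set is nonempty and bounded, so that the
   real-valued sup is the genuine supremum. *)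
Definition dual_norm (R : realType) (n : nat) (N : 'cV[R]_n -> R)
    (x : 'cV[R]_n) : R :=
  sup [set dot x y | y in [set y | N y <= 1]].

Notation borel T := (g_sigma_algebraType (@open T)).

Definition finite_moment (R : realType) (d : measure_display)
    (T : measurableType d) (P : probability T R) (N : T -> R) : Prop :=
  ('E_P[N] < +oo)%E.

(* Joint Borel distributions on the topological product.  Finiteness of the
   first moment does not depend on the choice of a norm on the product, here
   the sum norm.  Marginals are compared on Borel sets only, because a measure
   is a function on all sets, unspecified on nonmeasurable ones. *)
Definition couplings (R : realType) (n : nat) (N : 'cV[R]_n -> R)
    (P1 P2 : probability (borel 'cV[R]_n) R) :
    set (probability (borel ('cV[R]_n * 'cV[R]_n)%type) R) :=
  [set pi : probability (borel ('cV[R]_n * 'cV[R]_n)%type) R |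
    finite_moment pi (fun z => N z.1 + N z.2) /\
    forall A : set (borel 'cV[R]_n), measurable A ->
      pi (fst @^-1` A) = P1 A /\ pi (snd @^-1` A) = P2 A].

Definition transport_cost (R : realType) (n : nat) (N : 'cV[R]_n -> R)
    (pi : probability (borel ('cV[R]_n * 'cV[R]_n)%type) R) : \bar R :=
  (\int[pi]_z (N (z.1 - z.2))%:E)%E.

Definition wasserstein1 (R : realType) (n : nat) (N : 'cV[R]_n -> R)
    (P1 P2 : probability (borel 'cV[R]_n) R) : \bar R :=
  ereal_inf [set transport_cost N pi | pi in couplings N P1 P2].

Definition wasserstein_ball (R : realType) (n : nat) (N : 'cV[R]_n -> R)
    (P0 : probability (borel 'cV[R]_n) R) (r : R) :
    set (probability (borel 'cV[R]_n) R) :=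
  [set P : probability (borel 'cV[R]_n) R |
    finite_moment P N /\ (wasserstein1 N P P0 <= r%:E)%E].

(* For nonempty compact X, the real-valued inf is the genuine infimum. *)
Definition regret (R : realType) (n : nat) (X : set 'cV[R]_n)
    (x w : 'cV[R]_n) : R :=
  dot w x - inf [set dot w y | y in X].

Definition CVaR (R : realType) (d : measure_display) (T : measurableType d)
    (alpha : R) (P : probability T R) (Z : T -> R) : \bar R :=
  ereal_inf [set (tau%:E + ((1 - alpha)^-1)%:E
                  * 'E_P[fun w => Num.max (Z w - tau)%R 0%R])%E
            | tau in [set: R]].

(* Main.v *)
Require Import Defs.
From HB Require Import structures.
From mathcomp Require Import all_boot all_order all_algebra.
From mathcomp Require Import all_classical all_reals all_analysis.
From mathcomp Require Import measurable_realfun lra.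

(** Write [s w] for the regret of [x] under the realization [w], and [L] for the
supremum of the dual norms of [x - v], [v] in [X].  Everything rests on two
properties of [s], a supremum of the linear functions [w |-> dot w (x - v)].
It is nonnegative and [L]-Lipschitz for [N] ([regret_lipschitz]), and it
dominates each of these linear functions ([dot_le_regret]).

Upper bound.  Integrating the Lipschitz inequality against a coupling of [P]
and [P0] whose cost is close to [r] shows that, for every threshold [tau], the
expected excess of [s] over [tau] under [P] is at most the one under [P0] plus
about [L * r] ([expectation_excess_le]).  This increment does not depend on
[tau], so it survives the infimum over [tau] ([CVaR_le_wasserstein1]).

Lower bound.  Since [s] is convex, its slope in a given direction is in general
attained only at infinity: a small displacement of the whole mass of [P0] need
not raise the regret at rate [L].  Instead, a small fraction [p] of the mass is
moved very far, by [(r / p) *: u], where [N u <= 1] and [dot (x - v) u] is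
close to [L].  The transport cost is at most [p * (r / p) = r]
([shift_mixture_wasserstein1]).  On the moved part the regret exceeds [tau] by
at least [(r / p) * dot (x - v) u - tau] up to an integrable error
([expectation_excess_shift_ge]), which contributes [r * dot (x - v) u - p * tau]
after weighting by [p].  Put [q = (1 - alpha)^-1] and [sigma = p * q].  The
terms in [tau] recombine so that at least [1 - sigma] times the objective of the
conditional value-at-risk under [P0] remains, and letting [sigma] tend to [0]
gives the claim ([CVaR_shift_mixture_ge]).  This argument treats all of
[alpha >= 0] and [r >= 0] at once.

Two prerequisites are of a different nature: the dual norm is a genuine
supremum because all norms on [R^n] are equivalent ([mx_norm_le_is_norm]), and
continuous functions are Borel on [R^n] and on its square. *)

Import Order.TTheory GRing.Theory Num.Theory.
Import numFieldTopology.Exports numFieldNormedType.Exports.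

Local Open Scope classical_set_scope.
Local Open Scope ring_scope.

Set Implicit Arguments.
Unset Strict Implicit.
Unset Printing Implicit Defensive.

(** * Norms on spaces of matrices *)

Section norm_theory.
Variables (R : realType) (V : lmodType R) (N : V -> R).
Hypothesis normN : is_norm N.

Lemma is_norm0 : N 0 = 0.
Proof. by rewrite -(scale0r (0 : V)) (is_norm_homog normN) normr0 mul0r. Qed.

Lemma is_normN x : N (- x) = N x.
Proof. by rewrite -scaleN1r (is_norm_homog normN) normrN1 mul1r. Qed.

Lemma is_norm_ge0 x : 0 <= N x.
Proof.
have := is_norm_triangle normN x (- x).
by rewrite subrr is_norm0 is_normN -mulr2n pmulrn_lge0.
Qed.

Lemma is_norm_distC x y : N (x - y) = N (y - x).
Proof. by rewrite -is_normN opprB. Qed.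

Lemma is_norm_lipschitz x y : `|N x - N y| <= N (x - y).
Proof.
have sub u v : N u - N v <= N (u - v).
  by rewrite lerBlDr; have := is_norm_triangle normN (u - v) v; rewrite subrK.
by rewrite ler_norml sub andbT lerNl opprB is_norm_distC sub.
Qed.

Lemma is_norm_sum (I : Type) (s : seq I) (F : I -> V) :
  N (\sum_(i <- s) F i) <= \sum_(i <- s) N (F i).
Proof.
elim/big_ind2 : _ => [|a b c d ab cd|//]; first by rewrite is_norm0.
by rewrite (le_trans (is_norm_triangle normN _ _))// lerD.
Qed.

End norm_theory.

Lemma mx_norm_coord_le (R : realType) m n (M : 'M[R]_(m, n)) i j :
  `|M i j| <= `|M|.
Proof.
by rewrite /Num.norm/= mx_normrE; apply/bigmax_geP; right; exists (i, j).
Qed.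

Lemma mx_norm_trmx (R : realType) m n (M : 'M[R]_(m, n)) : `|M^T| = `|M|.
Proof.
have le p q (A : 'M[R]_(p, q)) : `|A^T| <= `|A|.
  rewrite {1}/Num.norm/= mx_normrE; apply/bigmax_leP; split=> // -[i j] _ /=.
  by rewrite mxE mx_norm_coord_le.
by apply/eqP; rewrite eq_le le/= -{1}(trmxK M) le.
Qed.

Section norm_on_matrices.
Variables (R : realType) (m n : nat) (N : 'M[R]_(m, n) -> R).
Hypothesis normN : is_norm N.

Lemma is_norm_le_mx_norm : exists2 C, 0 <= C & forall x, N x <= C * `|x|.
Proof.
exists (\sum_(i < m) \sum_(j < n) N (delta_mx i j)).
  by do 2![apply: sumr_ge0 => ? _]; exact: is_norm_ge0.
move=> x; rewrite {1}(matrix_sum_delta x).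
apply: (le_trans (is_norm_sum normN _ _)).
rewrite mulr_suml; apply: ler_sum => i _.
apply: (le_trans (is_norm_sum normN _ _)).
rewrite mulr_suml; apply: ler_sum => j _.
rewrite (is_norm_homog normN) mulrC ler_wpM2l ?is_norm_ge0//.
exact: mx_norm_coord_le.
Qed.

(** One-sided Lipschitz bounds suffice, because exchanging [x] and [y] gives the
other side. *)
Lemma lipschitz_is_norm_continuous (f : 'M[R]_(m, n) -> R) (k : R) :
  (forall x y, f x <= f y + k * N (x - y)) -> continuous f.
Proof.
move=> lipf x; have [C C0 leC] := is_norm_le_mx_norm.
(* Adding 1 makes the Lipschitz constant positive, so that it can divide. *)
pose K := `|k| * C + 1; have K0 : 0 < K by rewrite ltr_pwDr ?mulr_ge0.
apply/(@cvgrPdist_lt _ _ _ _ (nbhs_filter x)) => e e0; near=> y.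
have lip u v : f u - f v <= K * `|u - v|.
  rewrite lerBlDl (le_trans (lipf u v))// lerD2l /K mulrDl mul1r -mulrA.
  rewrite ler_wpDr// (@le_trans _ _ (`|k| * N (u - v)))//.
    by rewrite ler_wpM2r ?ler_norm ?is_norm_ge0.
  by rewrite ler_wpM2l.
have : `|f x - f y| <= K * `|x - y|.
  by rewrite ler_norml lip andbT lerNl opprB distrC lip.
move=> /le_lt_trans; apply; rewrite mulrC -ltr_pdivlMr//.
near: y; apply/nbhs_ballP; exists (e / K); first by rewrite /= divr_gt0.
by move=> z; rewrite -ball_normE.
Unshelve. all: by end_near. Qed.

Lemma is_norm_continuous : continuous N.
Proof.
apply: (@lipschitz_is_norm_continuous N 1) => x y; rewrite mul1r -lerBlDl.
exact: le_trans (ler_norm _) (is_norm_lipschitz normN _ _).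
Qed.

End norm_on_matrices.

(** This is the half of the equivalence of norms that needs compactness: [N] is
continuous and positive on the unit sphere, so it has a positive minimum there.
The sphere is taken among row vectors, to which the Heine-Borel theorem
applies; it is empty exactly when [n = 0]. *)
Lemma mx_norm_le_is_norm (R : realType) n (N : 'cV[R]_n -> R) :
  is_norm N -> exists2 C, 0 <= C & forall x, `|x| <= C * N x.
Proof.
move=> normN; pose S := [set v : 'rV[R]_n | `|v| = 1].
have cS : compact S.
  apply: bounded_closed_compact.
    by exists 1; split => // y y1 v /= ->; exact: ltW.
  rewrite (_ : S = (fun v : 'rV_n => `|v|) @^-1` [set 1])//.
  apply: preimage_closed; last exact: closed_eq.
  by move=> v _; exact: norm_continuous.
pose M (v : 'rV[R]_n) := N v^T.
have normM : is_norm M.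
  split=> [x y|a x|x /(is_norm_eq0 normN) x0].
  - by rewrite /M linearD; exact: is_norm_triangle.
  - by rewrite /M linearZ; exact: is_norm_homog.
  - by apply: trmx_inj; rewrite x0 trmx0.
have unit (x : 'cV[R]_n) : x != 0 -> S (`|x|^-1 *: x^T).
  move=> x0; rewrite /S/= normrZ mx_norm_trmx normfV normr_id mulVf//.
  by rewrite normr_eq0.
have [S0|/set0P/negP/negPn/eqP S0] := pselect (S !=set0).
  have [|c cS' minc] := compact_EVT_min S0 cS (f := M).
    by apply: continuous_subspaceT; exact: is_norm_continuous.
  have {}cS' : S c by rewrite inE in cS'.
  have c0 : 0 < M c.
    rewrite lt_neqAle is_norm_ge0// andbT eq_sym.
    apply/eqP => /(is_norm_eq0 normM) c0.
    by move: cS'; rewrite /S/= c0 normr0 => /eqP; rewrite eq_sym oner_eq0.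
  exists (M c)^-1; first by rewrite invr_ge0 ltW.
  move=> x; have [->|x0] := eqVneq x 0.
    by rewrite normr0 (is_norm0 normN) mulr0.
  have xp : 0 < `|x| by rewrite normr_gt0.
  have := minc _ (mem_set (unit _ x0)).
  have -> : M (`|x|^-1 *: x^T) = N x / `|x|.
    rewrite /M linearZ/= trmxK (is_norm_homog normN) mulrC.
    by rewrite ger0_norm ?invr_ge0.
  by rewrite ler_pdivlMr// mulrC -ler_pdivlMr// mulrC.
exists 0 => // x; rewrite mul0r; have [->|x0] := eqVneq x 0.
  by rewrite normr0.
by have := unit _ x0; rewrite S0.
Qed.

(** * Dual norm and regret *)

Section dot_theory.
Variables (R : realType) (n : nat).
Implicit Types u v w : 'cV[R]_n.

Lemma dotDl u v w : dot (u + v) w = dot u w + dot v w.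
Proof. by rewrite /dot linearD/= mulmxDl mxE. Qed.

Lemma dotBr u v w : dot u (v - w) = dot u v - dot u w.
Proof. by rewrite /dot mulmxBr !mxE. Qed.

Lemma dotZr a u v : dot u (a *: v) = a * dot u v.
Proof. by rewrite /dot -scalemxAr mxE. Qed.

Lemma dotC u v : dot u v = dot v u.
Proof. by rewrite /dot -[in LHS](trmxK v) -trmx_mul mxE. Qed.

Lemma dotZl a u v : dot (a *: u) v = a * dot u v.
Proof. by rewrite dotC dotZr dotC. Qed.

Lemma dot0r u : dot u 0 = 0. Proof. by rewrite /dot mulmx0 mxE. Qed.

Lemma dot_le_mx_norm u v : dot u v <= n%:R * `|u| * `|v|.
Proof.
rewrite /dot mxE -mulrA mulr_natl -[X in _ *+ X]card_ord -sumr_const.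
apply: ler_sum => i _; rewrite mxE (le_trans (ler_norm _))// normrM.
by rewrite ler_pM// mx_norm_coord_le.
Qed.

End dot_theory.

Section dual_norm_theory.
Variables (R : realType) (n : nat) (N : 'cV[R]_n -> R).
Hypothesis normN : is_norm N.
Implicit Types x y z : 'cV[R]_n.

Lemma dual_norm_set_neq0 z : [set dot z y | y in [set y | N y <= 1]] !=set0.
Proof. by exists (dot z 0); exists 0 => //=; rewrite is_norm0. Qed.

Lemma dual_norm_set_bounded : exists2 C, 0 <= C & forall z y,
  N y <= 1 -> dot z y <= C * `|z|.
Proof.
have [C C0 leC] := mx_norm_le_is_norm normN.
exists (n%:R * C); first by rewrite mulr_ge0.
move=> z y y1; rewrite (le_trans (dot_le_mx_norm _ _))// mulrAC ler_wpM2r//.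
by rewrite ler_wpM2l// (le_trans (leC _))// ler_piMr.
Qed.

Lemma dual_norm_has_sup z : has_sup [set dot z y | y in [set y | N y <= 1]].
Proof.
split; first exact: dual_norm_set_neq0.
have [C _ leC] := dual_norm_set_bounded.
by exists (C * `|z|) => _ [y /= y1 <-]; exact: leC.
Qed.

Lemma dual_norm_le_mx_norm :
  exists2 C, 0 <= C & forall z, dual_norm N z <= C * `|z|.
Proof.
have [C C0 leC] := dual_norm_set_bounded; exists C => // z.
by apply: ge_sup => [|_ [y y1 <-]]; [exact: dual_norm_set_neq0|exact: leC].
Qed.

Lemma dot_le_dual_norm z y : dot z y <= dual_norm N z * N y.
Proof.
have [->|y0] := eqVneq y 0; first by rewrite dot0r is_norm0// mulr0.
have Ny0 : 0 < N y.
  rewrite lt_neqAle is_norm_ge0// andbT eq_sym.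
  by apply/eqP => /(is_norm_eq0 normN)/eqP; rewrite (negPf y0).
rewrite -ler_pdivrMr// mulrC -dotZr; apply: ub_le_sup.
  by case: (dual_norm_has_sup z).
exists ((N y)^-1 *: y) => //=.
rewrite (is_norm_homog normN) ger0_norm ?invr_ge0 ?(ltW Ny0)//.
by rewrite mulVf// gt_eqF.
Qed.

Lemma dual_norm_ge0 z : 0 <= dual_norm N z.
Proof.
apply: ub_le_sup; first by case: (dual_norm_has_sup z).
by exists 0; rewrite /= ?dot0r// is_norm0.
Qed.

End dual_norm_theory.

Section regret_theory.
Variables (R : realType) (n : nat) (N : 'cV[R]_n -> R).
Hypothesis normN : is_norm N.
Variables (X : set 'cV[R]_n) (x : 'cV[R]_n).
Hypotheses (X_compact : compact X) (Xx : X x).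

Let radius := sup [set dual_norm N (x - v) | v in X].

Let X_bounded : exists2 M, 0 <= M & forall v, X v -> `|v| <= M.
Proof.
have [M [_ leM]] := compact_bounded X_compact; exists (`|M| + 1) => [|v Xv].
  by rewrite addr_ge0.
by apply: leM => //; rewrite (le_lt_trans (ler_norm _))// ltrDl.
Qed.

Lemma dual_radius_has_sup : has_sup [set dual_norm N (x - v) | v in X].
Proof.
split; first by exists (dual_norm N (x - x)), x.
have [C C0 leC] := dual_norm_le_mx_norm normN.
have [M M0 leM] := X_bounded.
exists (C * (M + M)) => _ [v Xv <-]; rewrite (le_trans (leC _))//.
by rewrite ler_wpM2l// (le_trans (ler_normB _ _))// lerD ?leM.
Qed.

Lemma dual_radius_ub v : X v -> dual_norm N (x - v) <= radius.
Proof.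
by move=> Xv; apply: ub_le_sup; [case: dual_radius_has_sup|exists v].
Qed.

Lemma dual_radius_ge0 : 0 <= radius.
Proof. exact: le_trans (dual_norm_ge0 normN _) (dual_radius_ub Xx). Qed.

Let cost_has_lbound w : has_lbound [set dot w y | y in X].
Proof.
have [M M0 leM] := X_bounded; exists (- (n%:R * `|w| * M)) => _ [y Xy <-].
rewrite lerNl -mulN1r -dotZr scaleN1r (le_trans (dot_le_mx_norm _ _))//.
by rewrite normrN ler_wpM2l ?mulr_ge0// leM.
Qed.

Lemma dot_le_regret v w : X v -> dot w (x - v) <= regret X x w.
Proof.
move=> Xv; rewrite /regret dotBr lerB//; apply: ge_inf => //.
by exists v.
Qed.

Lemma regret_ge0 w : 0 <= regret X x w.
Proof. by rewrite (le_trans _ (dot_le_regret w Xx))// subrr dot0r. Qed.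

(** Passing from [w2] to [w1] changes each [dot w (x - v)] by
[dot (w1 - w2) (x - v)], hence by at most [radius * N (w1 - w2)]; the bound is
uniform in [v], so it passes to the supremum over [v] that defines the
regret. *)
Lemma regret_lipschitz w1 w2 :
  regret X x w1 <= regret X x w2 + radius * N (w1 - w2).
Proof.
rewrite {1}/regret lerBlDr -lerBlDl; apply: lb_le_inf.
  by exists (dot w1 x), x.
move=> _ [v Xv <-]; rewrite lerBlDr -lerBlDl -dotBr.
rewrite -[in dot w1 _](subrK w2 w1) addrC dotDl lerD ?dot_le_regret//.
rewrite dotC (le_trans (dot_le_dual_norm normN _ _))//.
by rewrite ler_wpM2r ?is_norm_ge0// dual_radius_ub.
Qed.

End regret_theory.

(** * Borel maps and mixtures of image measures *)

(** A Borel sigma-algebra is carried by a type that is at once pointed and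
topological; a product of two such types is again one, and this join makes the
lemmas below apply to [R^n * R^n]. *)
HB.instance Definition _ (T U : ptopologicalType) :=
  Topological.on (T * U)%type.

Section borel_measurability.

Lemma continuous_pair (S T U : topologicalType) (f : S -> T) (g : S -> U) :
  continuous f -> continuous g -> continuous (fun x => (f x, g x)).
Proof. by move=> cf cg x; apply: cvg_pair; [exact: cf|exact: cg]. Qed.

Lemma continuous_borel_measurable (T U : ptopologicalType) (f : T -> U) :
  continuous f -> measurable_fun setT (f : borel T -> borel U).
Proof.
move=> /continuousP cf.
apply: (@measurability _ _ (borel T) (borel U) setT f (@open U)) => //.
by move=> _ [A oA <-]; rewrite setTI; apply: sub_sigma_algebra; exact: cf.
Qed.

Lemma continuous_borel_measurable_real (T : ptopologicalType) (R : realType)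
    (f : T -> R) :
  continuous f -> measurable_fun setT (f : borel T -> R).
Proof.
move=> /continuousP cf.
apply: (@measurability _ _ (borel T) R setT f _
   (RGenOpens.measurableE R)).
move=> _ [_ [a [b ->] <-]]; rewrite setTI; apply: sub_sigma_algebra.
exact/cf/interval_open.
Qed.

End borel_measurability.

Definition mfun_of d d' (T : measurableType d) (U : measurableType d')
    (f : T -> U) (mf : measurable_fun setT f) : {mfun T >-> U} :=
  HB.pack f (isMeasurableFun.Build _ _ _ _ _ mf).

(** The law of a point that is drawn from [P] and then sent through [g] with
probability [p] and through [f] otherwise. *)
Section mixture_of_images.
Local Open Scope ereal_scope.
Context d d' (T : measurableType d) (U : measurableType d') (R : realType).
Variables (P : probability T R) (f g : {mfun T >-> U}) (p : R).
Hypothesis p01 : (0 <= p <= 1)%R.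

Let p_ge0 : (0 <= p)%R. Proof. by case/andP: p01. Qed.
Let q_ge0 : (0 <= 1 - p)%R. Proof. by rewrite subr_ge0; case/andP: p01. Qed.

Definition mixture_of_images := measure_add
  (mscale (NngNum q_ge0) (distribution P f))
  (mscale (NngNum p_ge0) (distribution P g)).

HB.instance Definition _ := Measure.on mixture_of_images.

Lemma mixture_of_imagesE A : mixture_of_images A =
  (1 - p)%:E * P (f @^-1` A) + p%:E * P (g @^-1` A).
Proof. by rewrite /mixture_of_images measure_addE. Qed.

Let mixture_setT : mixture_of_images setT = 1.
Proof.
rewrite mixture_of_imagesE !preimage_setT probability_setT !mule1 -EFinD.
by rewrite subrK.
Qed.

HB.instance Definition _ :=
  Measure_isProbability.Build _ _ _ mixture_of_images mixture_setT.

Lemma ge0_integral_mixture (h : U -> \bar R) :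
  measurable_fun [set: U] h -> (forall x, 0 <= h x) ->
  \int[mixture_of_images]_x h x =
  (1 - p)%:E * \int[P]_x h (f x) + p%:E * \int[P]_x h (g x).
Proof.
move=> mh h0; rewrite ge0_integral_measure_add// !ge0_integral_mscale//.
by rewrite !ge0_integral_pushforward//; try by move=> y _; exact: h0.
Qed.

End mixture_of_images.

Lemma ge0_integral_image d d' (T : measurableType d) (U : measurableType d')
    (R : realType) (P : probability T R) (Q : probability U R) (f : T -> U) :
  measurable_fun setT f ->
  (forall A, measurable A -> P (f @^-1` A) = Q A) ->
  forall h : U -> \bar R, measurable_fun [set: U] h ->
  (forall y, 0 <= h y)%E ->
  (\int[Q]_y h y = \int[P]_x h (f x))%E.
Proof.
move=> mf PQ h mh h0.
rewrite (eq_measure_integral (distribution P (mfun_of mf)));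
  last by move=> A mA _; symmetry; exact: PQ.
by rewrite ge0_integral_pushforward// => y _; exact: h0.
Qed.

(** * Conditional value-at-risk of a Lipschitz loss *)

Definition excess (R : realType) (T : Type) (s : T -> R) (tau : R) (w : T) :=
  Num.max (s w - tau) 0.

Section lipschitz_loss.
Local Open Scope ereal_scope.
Variables (R : realType) (n : nat) (N : 'cV[R]_n -> R).
Hypothesis normN : is_norm N.
Variables (s : 'cV[R]_n -> R) (L : R).
Hypotheses (L_ge0 : (0 <= L)%R) (s_ge0 : forall w, (0 <= s w)%R).
Hypothesis s_lip : forall w1 w2, (s w1 <= s w2 + L * N (w1 - w2))%R.

Local Notation V := 'cV[R]_n.
Local Notation T := (borel V).
Implicit Types (P : probability T R) (tau : R).

Local Notation excess := (@excess R V s).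

Let excess_ge0 tau w : (0 <= excess tau w)%R.
Proof. by rewrite le_max lexx orbT. Qed.

Let excess_lip tau w1 w2 :
  (excess tau w1 <= excess tau w2 + L * N (w1 - w2))%R.
Proof.
have := is_norm_ge0 normN (w1 - w2) => N0.
have := mulr_ge0 L_ge0 N0 => LN0; rewrite ge_max; apply/andP; split.
  rewrite (@le_trans _ _ (s w2 - tau + L * N (w1 - w2))%R)//.
    by rewrite addrAC lerD2r.
  by rewrite lerD2r le_max lexx.
by rewrite addr_ge0.
Qed.

Let measurable_is_norm : measurable_fun setT (N : T -> R).
Proof.
by apply: continuous_borel_measurable_real; exact: is_norm_continuous.
Qed.

Let measurable_excess tau : measurable_fun setT (excess tau : T -> R).
Proof.
apply: continuous_borel_measurable_real.
exact: lipschitz_is_norm_continuous (excess_lip tau).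
Qed.

Let norm_ge0E (w : V) : 0 <= (N w)%:E.
Proof. by rewrite lee_fin is_norm_ge0. Qed.

Lemma integral_affine_is_norm P (c k : R) : (0 <= c)%R -> (0 <= k)%R ->
  \int[P]_w (c + k * N w)%:E = c%:E + k%:E * \int[P]_w (N w)%:E.
Proof.
move=> c0 k0; under eq_integral do rewrite EFinD EFinM.
rewrite ge0_integralD//=.
- rewrite (integral_cst P measurableT).
  rewrite [X in _ * X + _](probability_setT P) mule1.
  rewrite ge0_integralZl//; exact/measurable_EFinP.
- by move=> w _; rewrite mule_ge0.
- apply: measurable_funeM; exact/measurable_EFinP.
Qed.

Let integral_dominated_lty P (h : V -> R) (c k : R) :
  finite_moment P N -> measurable_fun setT (h : T -> R) ->
  (0 <= c)%R -> (0 <= k)%R -> (forall w, 0 <= h w <= c + k * N w)%R ->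
  \int[P]_w (h w)%:E < +oo.
Proof.
rewrite /finite_moment unlock => PN mh c0 k0 hle.
apply: (@le_lt_trans _ _ (\int[P]_w (c + k * N w)%:E)).
  apply: ge0_le_integral => //.
  - by move=> w _; rewrite lee_fin; case/andP: (hle w).
  - exact/measurable_EFinP.
  - apply/measurable_EFinP/measurable_funD => //.
    exact: measurable_funM.
  - by move=> w _; rewrite lee_fin; case/andP: (hle w).
rewrite integral_affine_is_norm// lte_add_pinfty ?ltry//.
by rewrite lte_mul_pinfty// fin_numE.
Qed.

Let finite_excess P tau :
  finite_moment P N -> 'E_P[excess tau] \is a fin_num.
Proof.
move=> PN; rewrite ge0_fin_numE ?expectation_ge0// unlock.
apply: (@integral_dominated_lty P (excess tau) (excess tau 0%R) L) => // w.
by rewrite excess_ge0 -[in N w](subr0 w) excess_lip.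
Qed.

Let measurable_fst : measurable_fun setT (fst : borel (V * V)%type -> T).
Proof.
apply: (@continuous_borel_measurable (V * V)%type V) => z; exact: cvg_fst.
Qed.

Let measurable_snd : measurable_fun setT (snd : borel (V * V)%type -> T).
Proof.
apply: (@continuous_borel_measurable (V * V)%type V) => z; exact: cvg_snd.
Qed.

Let measurable_dist :
  measurable_fun setT ((fun z => N (z.1 - z.2)) : borel (V * V)%type -> R).
Proof.
apply: (@continuous_borel_measurable_real (V * V)%type) => z.
apply: continuous_comp; last exact: is_norm_continuous.
by apply: cvgB; [exact: cvg_fst|exact: cvg_snd].
Qed.

(** The positive part is 1-Lipschitz, so the excess inherits the constant [L] of
the loss whatever [tau] is.  Both expectations are rewritten as integrals
against the coupling, where the inequality holds pointwise. *)
Lemma expectation_excess_le (P1 P2 : probability T R) pi tau :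
  couplings N P1 P2 pi ->
  'E_P1[excess tau] <= 'E_P2[excess tau] + L%:E * transport_cost N pi.
Proof.
move=> [_ marg]; rewrite !unlock /transport_cost.
have mE : measurable_fun [set: T] (EFin \o excess tau).
  exact/measurable_EFinP.
have E0 y : 0 <= (EFin \o excess tau) y by rewrite lee_fin.
rewrite (ge0_integral_image measurable_fst (fun A mA => (marg A mA).1) mE)//.
rewrite (ge0_integral_image measurable_snd (fun A mA => (marg A mA).2) mE)//.
have mN : measurable_fun [set: borel (V * V)%type]
    (EFin \o (fun z => N (z.1 - z.2))).
  by apply/measurable_EFinP; exact: measurable_dist.
rewrite -ge0_integralZl_EFin//.
have m1 := measurableT_comp mE measurable_fst.
have m2 := measurableT_comp mE measurable_snd.
have mD : measurable_fun [set: borel (V * V)%type]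
    (fun z => L%:E * (N (z.1 - z.2))%:E).
  exact: measurable_funeM.
rewrite -ge0_integralD//; last first.
  by move=> z _; rewrite mule_ge0// lee_fin is_norm_ge0.
apply: ge0_le_integral => //.
  exact: emeasurable_funD.
by move=> z _; rewrite lee_fin excess_lip.
Qed.

Variable alpha : R.
Hypotheses (alpha_ge0 : (0 <= alpha)%R) (alpha_lt1 : (alpha < 1)%R).

Let inv1alpha_gt0 : (0 < (1 - alpha)^-1)%R.
Proof. by rewrite invr_gt0 subr_gt0. Qed.

Lemma CVaR_le P tau :
  CVaR alpha P s <= tau%:E + (1 - alpha)^-1%:E * 'E_P[excess tau].
Proof. by apply: ereal_inf_lbound; exists tau. Qed.

(** The threshold 0 gives a finite upper bound.  Conversely every value of the
objective is nonnegative: for [tau < 0] the expected excess is at least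
[- tau], and its weight [(1 - alpha)^-1] is at least 1. *)
Lemma CVaR_fin_num P : finite_moment P N -> CVaR alpha P s \is a fin_num.
Proof.
move=> PN; apply/fin_numPlt/andP; split; last first.
  apply: (le_lt_trans (CVaR_le P 0)).
  by rewrite add0e lte_mul_pinfty ?lee_fin ?ltW// ltey_eq finite_excess.
apply: (@lt_le_trans _ _ 0); rewrite ?ltNyr//.
apply: le_ereal_inf_tmp => _ [tau _ <-].
have : (Num.max (- tau) 0)%:E <= 'E_P[excess tau].
  rewrite -[leLHS](@expectation_cst _ _ _ P) !unlock.
  apply: ge0_le_integral => //.
  - by move=> w _; rewrite lee_fin le_max lexx orbT.
  - by apply/measurable_EFinP; exact: measurable_cst.
  - by apply/measurable_EFinP; exact: measurable_excess.
  - by move=> w _; rewrite lee_fin le_max2// lerDr.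
rewrite -(fineK (finite_excess tau PN)) lee_fin => excess_ge.
rewrite -EFinM -EFinD lee_fin.
have /andP[tauf f0] : (- tau <= fine 'E_P[excess tau])%R &&
    (0 <= fine 'E_P[excess tau])%R by rewrite -ge_max.
have : (fine 'E_P[excess tau] <= (1 - alpha)^-1 * fine 'E_P[excess tau])%R.
  by rewrite ler_peMl// invf_ge1 ?subr_gt0// gerBl.
by rewrite -lerBlDl sub0r => /(le_trans tauf).
Qed.

Lemma CVaR_le_wasserstein1 (P1 P2 : probability T R) (r : R) :
  wasserstein1 N P1 P2 <= r%:E ->
  CVaR alpha P1 s <= CVaR alpha P2 s + (r / (1 - alpha) * L)%:E.
Proof.
move=> W; apply/lee_addgt0Pr => e e0.
pose k := ((1 - alpha)^-1 * L)%R.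
have k0 : (0 <= k)%R by rewrite mulr_ge0// ltW.
(* The Wasserstein infimum need not be attained, so a coupling is taken within
   [e'] of it; [k + 1] rather than [k] because [k] may vanish. *)
pose e' := (e / (k + 1))%R.
have e'0 : (0 < e')%R by rewrite divr_gt0// ltr_wpDl.
have ke' : (k * e' <= e)%R.
  by rewrite /e' mulrCA ger_pMr// ler_pdivrMr ?ltr_wpDl// mul1r lerDl.
have : wasserstein1 N P1 P2 < (r + e')%:E.
  by rewrite (le_lt_trans W)// lte_fin ltrDl.
move=> /ereal_inf_lt[_ [pi cpi <-]] /ltW cost.
suff : CVaR alpha P1 s - (k * (r + e'))%:E <= CVaR alpha P2 s.
  rewrite leeBlDr// => /le_trans; apply; rewrite -addeA -EFinD.
  rewrite leeD2l// lee_fin mulrDr -mulrA mulrC mulrA.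
  by rewrite lerD// mulrA.
apply: le_ereal_inf_tmp => _ [tau _ <-]; rewrite leeBlDr//.
apply: (le_trans (CVaR_le P1 tau)); rewrite -addeA leeD2l//.
have -> : ((1 - alpha)^-1%:E * 'E_P2[excess tau] + (k * (r + e'))%:E =
    (1 - alpha)^-1%:E * ('E_P2[excess tau] + (L * (r + e'))%:E)).
  by rewrite muleDr ?fin_num_adde_defl// -EFinM mulrA.
apply: lee_wpmul2l; first by rewrite lee_fin ltW.
apply: (le_trans (expectation_excess_le tau cpi)); rewrite leeD2l// EFinM.
by rewrite lee_wpmul2l.
Qed.

(** Move a fraction [p] of the mass of [P0] by [t *: u] and keep the rest. *)
Section shift_mixture.
Variables (P0 : probability T R) (p t : R) (u : V).
Hypotheses (P0N : finite_moment P0 N) (p01 : (0 <= p <= 1)%R) (t0 : (0 <= t)%R).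

Let shift (w : V) : V := (w + t *: u)%R.

Let shift_continuous : continuous shift.
Proof.
move=> w; apply: (@cvgD _ _ _ _ (nbhs_filter w)); first exact: cvg_id.
exact: cvg_cst.
Qed.

Let measurable_shift : measurable_fun setT (shift : T -> T).
Proof. exact: (@continuous_borel_measurable V V). Qed.

Let measurable_comp_shift (h : V -> R) :
  measurable_fun setT (h : T -> R) -> measurable_fun setT (h \o shift : T -> R).
Proof. by move=> mh; exact: (measurableT_comp mh measurable_shift). Qed.

Let measurable_idT : measurable_fun setT (id : T -> T).
Proof. exact: measurable_id. Qed.

Let measurable_diag :
  measurable_fun setT ((fun w => (w, w)) : T -> borel (V * V)%type).
Proof.
apply: (@continuous_borel_measurable V (V * V)%type).
by apply: continuous_pair => w; exact: cvg_id.
Qed.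

Let measurable_shift_pair :
  measurable_fun setT ((fun w => (shift w, w)) : T -> borel (V * V)%type).
Proof.
apply: (@continuous_borel_measurable V (V * V)%type).
by apply: continuous_pair => // w; exact: cvg_id.
Qed.

Definition shift_mixture : probability T R :=
  mixture_of_images P0 (mfun_of measurable_idT) (mfun_of measurable_shift)
    p01.

(** Couples each point with its origin, at cost 0 on the part that stays. *)
Let plan : probability (borel (V * V)%type) R :=
  mixture_of_images P0 (mfun_of measurable_diag)
    (mfun_of measurable_shift_pair) p01.

Let shift_mixtureE A :
  shift_mixture A = (1 - p)%:E * P0 A + p%:E * P0 (shift @^-1` A).
Proof. exact: mixture_of_imagesE. Qed.

Let planE A : plan A = (1 - p)%:E * P0 ((fun w => (w, w)) @^-1` A) +
  p%:E * P0 ((fun w => (shift w, w)) @^-1` A).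
Proof. exact: mixture_of_imagesE. Qed.

Let mixture_lty (a b : \bar R) :
  a < +oo -> b < +oo -> (1 - p)%:E * a + p%:E * b < +oo.
Proof.
case/andP: p01 => p0 p1 aoo boo.
by rewrite lte_add_pinfty// lte_mul_pinfty// lee_fin// subr_ge0.
Qed.

Let N_shift_le w : (N (shift w) <= N (t *: u) + N w)%R.
Proof. by rewrite addrC; exact: is_norm_triangle. Qed.

Lemma shift_mixture_moment : finite_moment shift_mixture N.
Proof.
rewrite /finite_moment unlock ge0_integral_mixture//;
  last exact/measurable_EFinP.
apply: mixture_lty; first by move: P0N; rewrite /finite_moment unlock.
apply: (@integral_dominated_lty P0 (N \o shift) (N (t *: u)) 1) => //.
- exact: measurable_comp_shift.
- exact: is_norm_ge0.
- by move=> w; rewrite /= mul1r N_shift_le is_norm_ge0.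
Qed.

Lemma shift_mixture_wasserstein1 :
  wasserstein1 N shift_mixture P0 <= (p * (t * N u))%:E.
Proof.
have mN1 := measurableT_comp measurable_is_norm measurable_fst.
have mN2 := measurableT_comp measurable_is_norm measurable_snd.
have N0 := is_norm_ge0 normN.
apply: ge_ereal_inf; exists (transport_cost N plan).
  exists plan => //; split; last first.
    move=> A mA; rewrite !planE shift_mixtureE; split=> //.
    change ((1 - p)%:E * P0 A + p%:E * P0 A = P0 A).
    case/andP: p01 => p0 p1.
    by rewrite -ge0_muleDl ?lee_fin ?subr_ge0// -EFinD subrK mul1e.
  rewrite /finite_moment unlock ge0_integral_mixture/=; last 2 first.
  - by apply/measurable_EFinP; exact: measurable_funD.
  - by move=> z; rewrite lee_fin addr_ge0.
  apply: mixture_lty.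
    apply: (@integral_dominated_lty P0 (fun w => N w + N w)%R 0 2) => //.
    - exact: measurable_funD.
    - by move=> w; rewrite addr_ge0//= add0r mulr2n mulrDl mul1r.
  apply: (@integral_dominated_lty P0 (fun w => N (shift w) + N w)%R
    (N (t *: u)) 2) => //.
  - by apply: measurable_funD => //; exact: measurable_comp_shift.
  - by move=> w; rewrite addr_ge0//= mulr2n mulrDl mul1r addrA lerD2r.
rewrite /transport_cost ge0_integral_mixture/=; last 2 first.
- by apply/measurable_EFinP; exact: measurable_dist.
- by move=> z; rewrite lee_fin.
under eq_integral do rewrite subrr (is_norm0 normN).
rewrite integral0 mule0 add0e.
under eq_integral do rewrite /shift addrAC subrr add0r.
rewrite (integral_cst P0 measurableT).
rewrite [X in _ * (_ * X)](probability_setT P0) mule1.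
by rewrite -EFinM (is_norm_homog normN) ger0_norm.
Qed.

Lemma expectation_shift_mixture (h : V -> R) :
  measurable_fun setT (h : T -> R) -> (forall w, 0 <= h w)%R ->
  'E_shift_mixture[h] = (1 - p)%:E * 'E_P0[h] + p%:E * 'E_P0[h \o shift].
Proof.
move=> mh h0; rewrite !unlock ge0_integral_mixture//.
exact/measurable_EFinP.
Qed.

(** The error term [L * N w] is kept on the right so that all the integrands are
nonnegative; the maximum with 0 in the proof serves the same purpose on the
left. *)
Lemma expectation_excess_shift_ge (d tau : R) :
  (forall w, t * d <= s (shift w) + L * N w)%R ->
  (t * d - tau)%:E <= 'E_P0[excess tau \o shift] + L%:E * 'E_P0[N].
Proof.
move=> grow; apply: (@le_trans _ _ (Num.max (t * d - tau) 0)%:E).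
  by rewrite lee_fin le_max lexx.
have mES : measurable_fun [set: T] (EFin \o (excess tau \o shift)).
  by apply/measurable_EFinP; exact: measurable_comp_shift.
have mEN : measurable_fun [set: T] (EFin \o N) by exact/measurable_EFinP.
have mLN : measurable_fun [set: T] (fun w => L%:E * (N w)%:E).
  exact: measurable_funeM.
rewrite -[leLHS](@expectation_cst _ _ _ P0) !unlock.
rewrite -ge0_integralZl_EFin// -ge0_integralD//; last 2 first.
- by move=> w _; rewrite lee_fin; exact: excess_ge0.
- by move=> w _; rewrite mule_ge0.
apply: ge0_le_integral => //.
- by move=> w _; rewrite lee_fin le_max lexx orbT.
- by apply/measurable_EFinP; exact: measurable_cst.
- exact: emeasurable_funD.
- move=> w _; rewrite /= -EFinM -EFinD lee_fin ge_max; apply/andP; split.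
    by rewrite lerBlDr (le_trans (grow w))// addrAC lerD2r -lerBlDr le_max lexx.
  by rewrite addr_ge0// mulr_ge0// is_norm_ge0.
Qed.

Lemma expectation_excess_shift_fin_num tau :
  'E_P0[excess tau \o shift] \is a fin_num.
Proof.
rewrite ge0_fin_numE ?expectation_ge0// => [|w]; last exact: excess_ge0.
rewrite unlock.
apply: (@integral_dominated_lty P0 (excess tau \o shift)
  (excess tau 0%R + L * N (t *: u)) L) => //.
- exact: measurable_comp_shift.
- by rewrite addr_ge0// mulr_ge0// is_norm_ge0.
move=> w; rewrite excess_ge0 -addrA -mulrDr.
rewrite (le_trans (excess_lip _ _ 0))// subr0 lerD2l ler_wpM2l//.
Qed.

End shift_mixture.

(** [d] is an asymptotic slope of the loss in the direction [u], up to an error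
that does not depend on the length [t] of the displacement.  Moving less and
less mass further and further away makes this error negligible, at the fixed
budget [r]. *)
Lemma CVaR_shift_mixture_ge (P0 : probability T R) (r d e : R) (u : V) :
  finite_moment P0 N -> (0 <= r)%R -> (N u <= 1)%R -> (0 < e)%R ->
  (forall w t, 0 <= t -> t * d <= s (w + t *: u) + L * N w)%R ->
  exists2 P, wasserstein_ball N P0 r P &
    CVaR alpha P0 s + (r / (1 - alpha) * d)%:E <= CVaR alpha P s + e%:E.
Proof.
move=> P0N r0 u1 e0 grow.
have [C CE] : exists C, CVaR alpha P0 s = C%:E.
  by exists (fine (CVaR alpha P0 s)); rewrite fineK// CVaR_fin_num.
have [m mE] : exists m, 'E_P0[N] = m%:E.
  exists (fine 'E_P0[N]); rewrite fineK// ge0_fin_numE//.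
  by apply: expectation_ge0 => w; exact: is_norm_ge0.
have m0 : (0 <= m)%R.
  by rewrite -lee_fin -mE; apply: expectation_ge0 => w; exact: is_norm_ge0.
pose q := ((1 - alpha)^-1)%R.
have q1 : (1 <= q)%R by rewrite invf_ge1 ?subr_gt0// gerBl.
have q0 : (0 < q)%R by exact: inv1alpha_gt0.
(* With [p * q = sg], the value reached falls short of the claimed one by at
   most [sg * (C + L * m)], which the choice of [sg] keeps below [e]. *)
pose b := (`|C| + L * m)%R.
have b0 : (0 <= b)%R by rewrite addr_ge0// mulr_ge0.
pose sg := (e / (e + b))%R.
have eb0 : (0 < e + b)%R by rewrite ltr_wpDr.
have sg0 : (0 < sg)%R by rewrite divr_gt0.
have sg1 : (sg <= 1)%R by rewrite ler_pdivrMr// mul1r lerDl.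
have sgb : (sg * b <= e)%R.
  by rewrite /sg mulrAC ler_pdivrMr// ler_pM2l// lerDr ltW.
pose p := (sg / q)%R.
have p0 : (0 < p)%R by rewrite divr_gt0.
have psg : (p <= sg)%R by rewrite ler_pdivrMr// ler_peMr// ltW.
have p01 : (0 <= p <= 1)%R by rewrite ltW//= (le_trans psg).
have t0 : (0 <= r / p)%R by rewrite divr_ge0// ltW.
exists (shift_mixture P0 (r / p) u p01).
  split; first exact: shift_mixture_moment.
  apply: (le_trans (shift_mixture_wasserstein1 _ P0N _ t0)).
  by rewrite lee_fin mulrA mulrCA divff ?gt_eqF// mulr1 ler_piMr.
rewrite -leeBlDr//; apply: le_ereal_inf_tmp => _ [tau _ <-].
rewrite leeBlDr// CE.
rewrite (expectation_shift_mixture _ _ _ p01 (measurable_excess tau))//.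
have := CVaR_le P0 tau; rewrite CE.
have := expectation_excess_shift_ge P0 tau (fun w => grow w _ t0).
have := expectation_ge0 P0 (excess_ge0 tau).
rewrite mE -(fineK (finite_excess tau P0N)).
rewrite -(fineK (expectation_excess_shift_fin_num (r / p) u P0N tau)).
set f0 := fine _; set f1 := fine _.
rewrite -!EFinM -!EFinD !lee_fin -/q => f0_ge0 Hf1 HC.
have qp : (q * p = sg)%R by rewrite /p mulrCA divff ?mulr1// gt_eqF.
have sgt : (sg * (r / p) = r * q)%R.
  by rewrite -qp mulrCA -mulrA divff ?mulr1 1?mulrC// gt_eqF.
(* Once products are expanded, the goal is a linear combination of these. *)
have : (sg * (r / p * d - tau) <= sg * (f1 + L * m))%R by rewrite ler_pM2l.
have : (sg * (C + L * m) <= e)%R.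
  by rewrite (le_trans _ sgb)// ler_pM2l// lerD2r ler_norm.
have : ((1 - sg) * C <= (1 - sg) * (tau + q * f0))%R.
  by rewrite ler_wpM2l// subr_ge0.
have : (q * f0 * p <= q * f0 * sg)%R by rewrite ler_wpM2l// mulr_ge0// ltW.
have : (q * p * f1 = sg * f1)%R by rewrite qp.
have : (sg * (r / p) * d = r * q * d)%R by rewrite sgt.
move: (r / p)%R Hf1 => t Hf1 sgtd qpe1.
clearbody p sg b q.
lra.
Qed.

End lipschitz_loss.

(** * The worst case over the Wasserstein ball *)

Theorem theorem3 (R : realType) (n : nat) (N : 'cV[R]_n -> R)
    (normN : is_norm N)
    (P0 : probability (borel 'cV[R]_n) R) (P0_moment : finite_moment P0 N)
    (r : R) (r_ge0 : 0 <= r)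
    (X : set 'cV[R]_n) (X_neq0 : X !=set0) (X_compact : compact X)
    (alpha : R) (alpha_ge0 : 0 <= alpha) (alpha_lt1 : alpha < 1)
    (x : 'cV[R]_n) (Xx : X x) :
  ereal_sup [set CVaR alpha P (regret X x) | P in wasserstein_ball N P0 r] =
  (CVaR alpha P0 (regret X x) +
   (r / (1 - alpha) * sup [set dual_norm N (x - v) | v in X])%:E)%E.
Proof.
set L := sup _.
have L0 : 0 <= L by exact: dual_radius_ge0.
have s0 := @regret_ge0 _ _ X x X_compact Xx.
have slip := @regret_lipschitz _ _ N normN X x X_compact Xx.
apply/eqP; rewrite eq_le; apply/andP; split.
  apply: ge_ereal_sup => _ [P [_ W] <-].
  exact: (@CVaR_le_wasserstein1 _ _ N normN _ L).
apply/lee_addgt0Pr => e e0.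
pose k := r / (1 - alpha).
have k0 : 0 <= k by rewrite divr_ge0// subr_ge0 ltW.
(* Half of [e] pays for the choice of [v] and [u], each within [e2] of its
   supremum, and the other half for moving a small but nonzero mass. *)
pose e1 := e / 2; have e10 : 0 < e1 by rewrite divr_gt0.
pose e2 := e1 / (k + 1) / 2.
have e20 : 0 < e2 by rewrite !divr_gt0// ltr_wpDl.
have ke2 : k * (e2 + e2) <= e1.
  rewrite /e2 -splitr mulrCA ger_pMr// ler_pdivrMr ?ltr_wpDl//.
  by rewrite mul1r lerDl.
have [_ [v Xv <-] Lv] :=
  sup_adherent e20 (dual_radius_has_sup normN X_compact Xx).
have [_ [u u1 <-] vu] :=
  sup_adherent e20 (dual_norm_has_sup normN (x - v)).
rewrite -/L -/(dual_norm N (x - v)) in Lv vu.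
have grow w t : 0 <= t ->
    t * dot (x - v) u <= regret X x (w + t *: u) + L * N w.
  move=> _; have := dot_le_regret x X_compact (w + t *: u) Xv.
  rewrite (dotDl w) dotZl (dotC u); rewrite -(lerD2r (L * N w)).
  apply: le_trans; rewrite addrAC lerDr -lerBlDl sub0r.
  rewrite dotC -mulN1r -dotZr scaleN1r.
  rewrite (le_trans (dot_le_dual_norm normN _ _))//.
  by rewrite is_normN// ler_wpM2r ?is_norm_ge0// dual_radius_ub.
have [P PB] := CVaR_shift_mixture_ge normN L0 s0 slip alpha_ge0 alpha_lt1
  P0_moment r_ge0 u1 e10 grow.
rewrite -/k => H.
have kL : k * L <= k * dot (x - v) u + e1.
  rewrite -lerBlDl -mulrBr (le_trans _ ke2)// ler_wpM2l//.
  by rewrite lerBlDl; move: Lv vu; lra.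
apply: (@le_trans _ _ (CVaR alpha P (regret X x) + e1%:E + e1%:E)%E).
  by apply: (le_trans _ (leeD2r _ H)); rewrite -addeA leeD2l// -EFinD lee_fin.
by rewrite -addeA -EFinD -splitr leeD2r// ereal_sup_ubound//; exists P.
Qed.
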